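(* Let $\mathcal H$ be a complex Hilbert space, $\Omega$ a set, $\mathcal A$ an algebra of subsets of $\Omega$, $\Sigma$ the σ-algebra generated by $\mathcal A$, and $\{p_A:A\in\mathcal A\}$ a projection valued measure on $\mathcal A$. Then there exists a projection valued measure $\{p_A:A\in\mathcal M\}$ extending it to $\mathcal M$. For every $\phi\in\mathcal H$ and $A\in\mathcal M$, $\|p_A\phi\|^2=M_\phi(A)$. For $A\in\mathcal M$ the range of $p_A$ is $\mathcal H_A=\{\phi\in\mathcal H:M_\phi(A)=\|\phi\|^2\}$, and $$\mathcal H_A=\bigcap\{\mathcal H_B:B\in\mathcal A_\sigma,\ A\subset B\}.$$ Furthermore, $\{p_A:A\in\Sigma\}$ is the unique projection valued measure on $\Sigma$ extending $\{p_A:A\in\mathcal A\}$.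
   Context: A projection is a bounded self-adjoint idempotent operator on $\mathcal H$. A family $\{p_A:A\in\mathcal C\}$ of projections indexed by an algebra (or σ-algebra) $\mathcal C$ of subsets of $\Omega$ is a projection valued measure if $p_\Omega=I$ and, whenever $A_1,A_2,\dots\in\mathcal C$ are disjoint with $A=\bigcup_iA_i\in\mathcal C$, $p_A=\sum_ip_{A_i}$ (meaning $p_A\phi=\sum_ip_{A_i}\phi$ for every $\phi$). For $\phi\in\mathcal H$ and $A\in\mathcal A$ put $M_\phi(A)=\|p_A\phi\|^2$; for arbitrary $A\subset\Omega$ let $M^*_\phi(A)=\inf\{\sum_{i\ge1}M_\phi(A_i):A\subset\bigcup_iA_i,\ A_i\in\mathcal A\}$ be the outer measure, $\mathcal M_\phi$ the σ-algebra of $M^*_\phi$-measurable sets (in Carathéodory's sense), and $M_\phi(A)=M^*_\phi(A)$ for $A\in\mathcal M_\phi$. Let $\mathcal M=\bigcap_{\phi\in\mathcal H}\mathcal M_\phi$, a σ-algebra with $\mathcal A\subset\Sigma\subset\mathcal M$. $\mathcal A_\sigma$ denotes the family of countable unions of sets in $\mathcal A$. For $A\in\mathcal A$, $\mathcal H_A$ denotes the range of $p_A$. *)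

(* Defs.v *)
(* MathComp-Analysis + real_closed complex numbers R[i]. *)
From HB Require Import structures.
From mathcomp Require Import all_boot all_order all_algebra.
From mathcomp Require Import all_classical all_reals all_analysis.
From mathcomp.real_closed Require Import complex.
Set Implicit Arguments. Unset Strict Implicit. Unset Printing Implicit Defensive.
Import Order.TTheory GRing.Theory Num.Theory.
Import numFieldNormedType.Exports.
Local Open Scope classical_set_scope.
Local Open Scope ring_scope.

(** A complex Hilbert space is a complete normed space [H] over the complex
    numbers [R[i]] (R a real field) whose norm comes from an inner product
    [ip], linear in the first variable and conjugate symmetric. *)
Definition is_inner_product (R : realType) (H : normedModType R[i])
    (ip : H -> H -> R[i]) : Prop :=
  [/\ forall (a : R[i]) (x y z : H), ip (a *: x + y) z = a * ip x z + ip y z,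
      forall x y : H, ip y x = ((ip x y)^*)%C
    & forall x : H, ip x x = `|x| ^+ 2].

(** squared norm, as a real number *)
Definition sqnorm (R : realType) (H : normedModType R[i]) (x : H) : R :=
  (complex.Re `|x|) ^+ 2.

(** projection: bounded self-adjoint idempotent (linear) operator *)
Definition is_projection (R : realType) (H : normedModType R[i])
    (ip : H -> H -> R[i]) (P : H -> H) : Prop :=
  [/\ forall (a : R[i]) (x y : H), P (a *: x + y) = a *: P x + P y,
      exists c : R[i], forall x, `|P x| <= c * `|x|,
      forall x y, ip (P x) y = ip x (P y)
    & forall x, P (P x) = P x].

(** algebra of subsets of Omega *)
Definition is_algebra_of_sets (Omega : Type) (Alg : set (set Omega)) : Prop :=
  [/\ Alg setT,
      forall A, Alg A -> Alg (~` A)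
    & forall A B, Alg A -> Alg B -> Alg (A `|` B)].

(** projection valued measure indexed by the family C (values of p outside C
    are irrelevant) *)
Definition is_pvm (R : realType) (H : normedModType R[i])
    (ip : H -> H -> R[i]) (Omega : Type) (C : set (set Omega))
    (p : set Omega -> H -> H) : Prop :=
  [/\ forall A, C A -> is_projection ip (p A),
      forall phi, p setT phi = phi
    & forall F : (set Omega)^nat, (forall i, C (F i)) -> trivIset setT F ->
        C (\bigcup_i F i) ->
        forall phi, (fun n => \sum_(i < n) p (F i) phi) @ \oo
                      --> p (\bigcup_i F i) phi].

(** outer measure M*_phi built from M_phi(A) = ||p_A phi||^2 on Alg *)
Definition Mstar (R : realType) (H : normedModType R[i]) (Omega : Type)
    (Alg : set (set Omega)) (p : set Omega -> H -> H) (phi : H)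
    (X : set Omega) : \bar R :=
  ereal_inf [set (\sum_(i <oo) (sqnorm (p (F i) phi))%:E)%E
            | F in [set F : (set Omega)^nat |
                     (forall i, Alg (F i)) /\ X `<=` \bigcup_i F i]].

(** the sigma-algebra M = intersection over phi of the Caratheodory
    measurable sets of M*_phi *)
Definition Mcarath (R : realType) (H : normedModType R[i]) (Omega : Type)
    (Alg : set (set Omega)) (p : set Omega -> H -> H) : set (set Omega) :=
  [set A | forall phi : H, caratheodory_measurable (Mstar Alg p phi) A].

(** A_sigma: countable unions of sets of Alg *)
Definition Asigma (Omega : Type) (Alg : set (set Omega)) : set (set Omega) :=
  [set B | exists F : (set Omega)^nat, (forall i, Alg (F i)) /\ B = \bigcup_i F i].

(* Main.v *)
Require Import Defs.
From HB Require Import structures.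
From mathcomp Require Import all_boot all_order all_algebra.
From mathcomp Require Import all_classical all_reals all_analysis.
From mathcomp.real_closed Require Import complex.
From mathcomp Require Import ring lra.
Import Order.TTheory GRing.Theory Num.Theory.
Import numFieldNormedType.Exports.
Local Open Scope classical_set_scope.
Local Open Scope ring_scope.

Set Implicit Arguments.
Unset Strict Implicit.
Unset Printing Implicit Defensive.

(** A projection [P] is determined by its quadratic form [x |-> ||P x||^2], and
    [Q <= P] iff the form of [Q] is below that of [P]; moreover a downward
    directed family of projections converges strongly to a projection whose
    form is the infimum of the forms.  Hence everything can be read off the
    outer measures: [M*_phi(B)] is the form of a projection for [B] in
    [A_sigma] (limit along finite unions), and then for every [A] (infimum over
    the [B] in [A_sigma] containing [A]).  On [Mcarath] additivity of the
    forms is additivity of [M*_phi], which gives additivity of the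
    projections.  For uniqueness, a second extension [r] satisfies
    [||r_A phi||^2 <= M*_phi(A)], and the same bound for the complement of [A]
    forces equality. *)

(** The unused proof argument lets the structure of an algebra of sets be
    inferred on this copy of [T]. *)
Definition algebra_type (T : Type) (G : set (set T))
  (algG : is_algebra_of_sets G) : Type := T.

Lemma algebra_set0 (T : Type) (G : set (set T)) :
  is_algebra_of_sets G -> G set0.
Proof. by case=> GT GC _; rewrite -setCT; exact: GC. Qed.

Lemma algebra_setD (T : Type) (G : set (set T)) A B :
  is_algebra_of_sets G -> G A -> G B -> G (A `\` B).
Proof.
case=> GT GC GU GA GB; rewrite setDE -[A]setCK -setCU.
by apply: (GC); apply: GU => //; exact: GC.
Qed.

Lemma algebra_bigsetU (T : Type) (G : set (set T)) (F : (set T)^nat) n :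
  is_algebra_of_sets G -> (forall i, G (F i)) ->
  G (\big[setU/set0]_(i < n) F i).
Proof.
move=> algG GF; elim/big_ind : _ => //; first exact: algebra_set0.
by case: algG.
Qed.

(** * Caratheodory extension of a premeasure on an algebra of sets *)

Section premeasure_extension.
Variables (R : realType) (T : pointedType) (G : set (set T)).
Hypothesis algG : is_algebra_of_sets G.

HB.instance Definition _ := Pointed.on (algebra_type algG).
HB.instance Definition _ := @isAlgebraOfSets.Build default_measure_display
  (algebra_type algG) G (algebra_set0 algG) (let: And3 _ _ GU := algG in GU)
  (let: And3 _ GC _ := algG in GC).

Variable m : set T -> \bar R.
Hypotheses (m0 : m set0 = 0%E) (m_ge0 : forall A, (0 <= m A)%E).
Hypothesis m_sigma : forall F : (set T)^nat, (forall i, G (F i)) ->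
  trivIset setT F -> G (\bigcup_i F i) ->
  (fun n => \sum_(0 <= i < n) m (F i))%E @ \oo --> m (\bigcup_i F i).

(** A copy of [m] typed over [algebra_type algG], so that the measure structure declared below
    attaches to this name. *)
Definition algebra_premeasure of m set0 = 0%E :
  set (algebra_type algG) -> \bar R := m.

Let mu := algebra_premeasure m0.

HB.instance Definition _ := isMeasure.Build _ _ _ mu m0 m_ge0 m_sigma.

(** The outer measure [mu_ext] is by definition the infimum over countable covers from [G], so the
    first claim holds by computation. *)
Lemma pointed_premeasure_extension :
  exists nu : {outer_measure set T -> \bar R},
    [/\ forall X, nu X = ereal_inf [set (\sum_(i <oo) m (F i))%E
            | F in [set F : (set T)^nat |
                     (forall i, G (F i)) /\ X `<=` \bigcup_i F i]],
        forall A, G A -> nu A = m A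
      & <<s G >> `<=` nu.-caratheodory].
Proof.
exists (mu_ext mu : {outer_measure set (algebra_type algG) -> \bar R}).
split => //.
- by move=> A GA; exact: (@measurable_mu_extE _ _ _ mu).
- exact: (@sub_caratheodory _ _ _ mu).
Qed.

End premeasure_extension.

Lemma premeasure_extension (R : realType) (T : Type) (G : set (set T))
    (m : set T -> \bar R) :
  is_algebra_of_sets G -> m set0 = 0%E -> (forall A, (0 <= m A)%E) ->
  (forall F : (set T)^nat, (forall i, G (F i)) ->
    trivIset setT F -> G (\bigcup_i F i) ->
    (fun n => \sum_(0 <= i < n) m (F i))%E @ \oo --> m (\bigcup_i F i)) ->
  exists nu : {outer_measure set T -> \bar R},
    [/\ forall X, nu X = ereal_inf [set (\sum_(i <oo) m (F i))%E
            | F in [set F : (set T)^nat |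
                     (forall i, G (F i)) /\ X `<=` \bigcup_i F i]],
        forall A, G A -> nu A = m A
      & <<s G >> `<=` nu.-caratheodory].
Proof.
move=> algG m0 m_ge0 m_sigma.
(* The library's extension theorem needs a pointed type. *)
have [[w _]|/set0P/negP/negPn/eqP T0] := pselect ([set: T] !=set0).
  pose pT : pointedType := HB.pack T (gen_eqMixin T) (gen_choiceMixin T)
    (isPointed.Build T w).
  exact: (@pointed_premeasure_extension R pT G algG m).
(* Over an empty type every set is [set0], and the zero outer measure satisfies the three claims. *)
have E0 (X : set T) : X = set0 by rewrite -subset0 -T0.
pose z := (fun=> 0%E) : set T -> \bar R.
have zss : sigma_subadditive z by move=> F; exact: nneseries_ge0.
have zle : {homo z : A B / A `<=` B >-> (A <= B)%E} by [].
pose zM := isOuterMeasure.Build R T z erefl (fun=> lexx _) zle zss.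
pose nu : {outer_measure set T -> \bar R} := HB.pack z zM.
have nu0 X : nu X = 0%E by [].
exists nu; split.
- move=> X; rewrite nu0; apply/esym/eqP; rewrite eq_le; apply/andP; split.
    apply: ereal_inf_lbound; exists (fun=> set0).
      by split=> [_|]; [exact: algebra_set0|rewrite [X]E0].
    by rewrite eseries0.
  by apply: le_ereal_inf_tmp => _ [F _ <-]; exact: nneseries_ge0.
- by move=> A _; rewrite nu0 [A]E0 m0.
- by move=> A _ X; rewrite !nu0 adde0.
Qed.

(** Subadditivity gives one inequality; the other is the Caratheodory splitting inequality tested on
    the union itself, whose part outside the union is empty. *)
Lemma caratheodory_sigma_additive (R : realType) (T : Type)
    (mu : {outer_measure set T -> \bar R}) (F : (set T)^nat) :
  (forall i, mu.-caratheodory (F i)) -> trivIset setT F ->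
  mu (\bigcup_i F i) = (\sum_(i <oo) mu (F i))%E.
Proof.
move=> MF tF; apply/eqP; rewrite eq_le outer_measure_sigma_subadditive /=.
have := caratheodory_lime_le MF tF (\bigcup_i F i).
rewrite setICr outer_measure0 adde0 => /(le_trans _); apply.
rewrite le_eqVlt; apply/orP; left; apply/eqP/eq_eseriesr => i _.
by congr (mu _); apply/esym/setIidr; exact: bigcup_sup.
Qed.

Lemma caratheodory_finitely_additive (R : realType) (T : Type)
    (mu : {outer_measure set T -> \bar R}) (F : (set T)^nat) n :
  (forall i, mu.-caratheodory (F i)) -> trivIset setT F ->
  mu (\big[setU/set0]_(i < n) F i) = (\sum_(i < n) mu (F i))%E.
Proof.
move=> MF tF; have := caratheodory_additive MF tF n setT.
by rewrite setTI => ->; apply: eq_bigr => i _; rewrite setTI.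
Qed.

(** * Squared norms, the real inner product, and single projections *)

Section hilbert_projections.
Variables (R : realType) (H : normedModType R[i]).
Implicit Types (x y z : H).

(** The norm takes its values in [R[i]]; this rewriting moves comparisons of norms to [R]. *)
Lemma norm_realE x : `|x| = (complex.Re `|x|)%:C%C.
Proof. by rewrite RRe_real // normr_real. Qed.

Lemma Re_norm_ge0 x : 0 <= complex.Re `|x|.
Proof. by have := normr_ge0 x; rewrite norm_realE ler0c. Qed.

Lemma norm_lt_sqnorm x (e : R) : 0 < e -> (`|x| < e%:C%C) = (sqnorm x < e ^+ 2).
Proof.
move=> e0; rewrite norm_realE ltcR /sqnorm ltr_pXn2r// nnegrE ?(ltW e0)//.
exact: Re_norm_ge0.
Qed.

Lemma norm_le_sqnorm x y : (`|x| <= `|y|) = (sqnorm x <= sqnorm y).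
Proof.
by rewrite (norm_realE x) (norm_realE y) lecR /sqnorm ler_pXn2r// nnegrE
  Re_norm_ge0.
Qed.

Lemma gt0_complexP (e : R[i]) : 0 < e -> exists2 r : R, 0 < r & e = r%:C%C.
Proof.
move=> e0; have er : e = (complex.Re e)%:C%C by rewrite RRe_real // gtr0_real.
by exists (complex.Re e) => //; move: e0; rewrite {1}er ltcR.
Qed.

Lemma sqnorm_ge0 x : 0 <= sqnorm x.
Proof. exact: sqr_ge0. Qed.

Lemma sqnorm0 : sqnorm (0 : H) = 0.
Proof. by rewrite /sqnorm normr0 expr0n. Qed.

Lemma sqnorm_eq0 x : sqnorm x = 0 -> x = 0.
Proof.
by move=> /eqP; rewrite sqrf_eq0 => /eqP x0; apply/normr0_eq0; rewrite norm_realE x0.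
Qed.

Lemma cvg_sqnormP {T : Type} (F : set_system T) {FF : Filter F} (f : T -> H)
    (l : H) :
  f @ F --> l <-> forall e : R, 0 < e -> \forall t \near F, sqnorm (l - f t) < e.
Proof.
split=> [/cvgrPdist_lt fl e e0|fl].
  have se0 : 0 < Num.sqrt e by rewrite sqrtr_gt0.
  have := fl (Num.sqrt e)%:C%C; rewrite ltcR => /(_ se0); apply: filterS => t.
  by rewrite norm_lt_sqnorm // sqr_sqrtr // ltW.
apply/cvgrPdist_lt => _ /gt0_complexP[e e0 ->].
have := fl (e ^+ 2) (exprn_gt0 _ e0); apply: filterS => t.
by rewrite norm_lt_sqnorm.
Qed.

(** Follows from the reverse triangle inequality. A general filter is allowed because both sequences
    and directed families of projections occur later. *)
Lemma cvg_sqnorm {T : Type} (F : set_system T) {FF : Filter F} (f : T -> H)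
    (l : H) : f @ F --> l -> sqnorm (f t) @[t --> F] --> sqnorm l.
Proof.
move=> fl; rewrite /sqnorm.
suff nf : complex.Re `|f t| @[t --> F] --> complex.Re `|l|.
  by rewrite expr2; under eq_fun do rewrite expr2; exact: cvgM.
apply/cvgrPdist_lt => e e0; move/cvgrPdist_lt : fl => /(_ e%:C%C).
rewrite ltcR => /(_ e0); apply: filterS => t; rewrite -ltcR; apply: le_lt_trans.
have := lerB_dist l (f t); have := lerB_dist (f t) l.
rewrite distrC (norm_realE l) (norm_realE (f t)) (norm_realE (l - f t)).
rewrite -!rmorphB !lecR => h1 h2.
by rewrite ler_norml h2 andbT lerNl opprB.
Qed.

Variable ip : H -> H -> R[i].
Hypothesis hip : is_inner_product ip.

(** A real inner product with the same norm; [im_ip] recovers the imaginary part of [ip] from it. *)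
Definition rip x y : R := complex.Re (ip x y).

Lemma ipDl x y z : ip (x + y) z = ip x z + ip y z.
Proof. by case: hip => lin _ _; have := lin 1 x y z; rewrite scale1r mul1r. Qed.

Lemma ip0l z : ip 0 z = 0.
Proof. by apply: (addrI (ip 0 z)); rewrite -ipDl !addr0. Qed.

Lemma ipZl (a : R[i]) x z : ip (a *: x) z = a * ip x z.
Proof. by case: hip => lin _ _; have := lin a x 0 z; rewrite ip0l !addr0. Qed.

Lemma ReD (a b : R[i]) : complex.Re (a + b) = complex.Re a + complex.Re b.
Proof. by case: a b => ? ? []. Qed.

Lemma ripC x y : rip x y = rip y x.
Proof. by case: hip => _ sym _; rewrite /rip (sym x y); case: (ip x y). Qed.

Lemma ripDl x y z : rip (x + y) z = rip x z + rip y z.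
Proof. by rewrite /rip ipDl ReD. Qed.

Lemma ripNl x z : rip (- x) z = - rip x z.
Proof.
apply/eqP; rewrite -addr_eq0 -ripDl addNr /rip ip0l; exact/eqP.
Qed.

Lemma ripBl x y z : rip (x - y) z = rip x z - rip y z.
Proof. by rewrite ripDl ripNl. Qed.

Lemma ripDr x y z : rip z (x + y) = rip z x + rip z y.
Proof. by rewrite ripC ripDl !(ripC z). Qed.

Lemma ripBr x y z : rip z (x - y) = rip z x - rip z y.
Proof. by rewrite ripC ripBl !(ripC z). Qed.

Lemma rip_sqnorm x : rip x x = sqnorm x.
Proof.
case: hip => _ _ nrm.
by rewrite /rip nrm norm_realE -rmorphXn.
Qed.

Lemma sqnormD x y : sqnorm (x + y) = sqnorm x + sqnorm y + 2 * rip x y.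
Proof.
by rewrite -!rip_sqnorm !ripDl !ripDr (ripC y x); ring.
Qed.

Lemma sqnormB x y : sqnorm (x - y) = sqnorm x + sqnorm y - 2 * rip x y.
Proof.
rewrite sqnormD ripC ripNl ripC mulrN; congr (_ + _ + _).
by rewrite /sqnorm normrN.
Qed.

Lemma rip_ext x y : (forall z, rip x z = rip y z) -> x = y.
Proof.
move=> xy; apply/eqP; rewrite -subr_eq0; apply/eqP/sqnorm_eq0.
by rewrite -rip_sqnorm ripBl xy subrr.
Qed.

(** By polarization [rip] is a combination of squared norms, which pass to the limit. *)
Lemma cvg_ripl {T : Type} (F : set_system T) {FF : Filter F} (f : T -> H)
    (l y : H) : f @ F --> l -> rip (f t) y @[t --> F] --> rip l y.
Proof.
have ripE x : rip x y = (sqnorm (x + y) - sqnorm x - sqnorm y) / 2.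
  by rewrite sqnormD; field.
move=> fl; rewrite ripE; under eq_fun do rewrite ripE.
apply: cvgMl; apply: cvgB; last exact: cvg_cst.
apply: cvgB; last exact: cvg_sqnorm.
by apply: cvg_sqnorm; apply: cvgD => //; exact: cvg_cst.
Qed.

Lemma im_ip x y : complex.Im (ip x y) = - rip ('i%C *: x) y.
Proof. by rewrite /rip ipZl mulrC ReiNIm opprK. Qed.

(** Boundedness holds with constant 1, since [||x||^2 - ||P x||^2 = ||x - P x||^2]; the imaginary
    part of self-adjointness is the real identity taken at [i x]. *)
Lemma is_projection_rip (P : H -> H) :
  (forall (a : R[i]) x y, P (a *: x + y) = a *: P x + P y) ->
  (forall x y, rip (P x) y = rip x (P y)) ->
  (forall x, P (P x) = P x) -> is_projection ip P.
Proof.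
move=> lin adj idem.
have P0 : P 0 = 0.
  by apply: (addrI (P 0)); have := lin 1 0 0; rewrite !scale1r !addr0.
have PZ a x : P (a *: x) = a *: P x by have := lin a x 0; rewrite P0 !addr0.
split => // [|x y].
- exists 1 => x; rewrite mul1r norm_le_sqnorm -subr_ge0.
  rewrite (_ : _ - _ = sqnorm (x - P x)) ?sqnorm_ge0// sqnormB.
  have -> : rip x (P x) = sqnorm (P x) by rewrite -rip_sqnorm adj idem.
  by ring.
- apply/eqP; rewrite eq_complex; apply/andP; split; apply/eqP; first exact: adj.
  by rewrite !im_ip -PZ adj.
Qed.

Section projection.
Variable P : H -> H.
Hypothesis hP : is_projection ip P.

Lemma projectionD x y : P (x + y) = P x + P y.
Proof. by case: hP => lin _ _ _; have := lin 1 x y; rewrite !scale1r. Qed.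

Lemma projectionB x y : P (x - y) = P x - P y.
Proof.
by apply/eqP; rewrite eq_sym subr_eq -projectionD subrK.
Qed.

Lemma projection_idem x : P (P x) = P x.
Proof. by case: hP. Qed.

Lemma projection_rip x y : rip (P x) y = rip x (P y).
Proof. by case: hP => _ _ adj _; rewrite /rip adj. Qed.

Lemma sqnorm_projection x : sqnorm (P x) = rip (P x) x.
Proof. by rewrite -rip_sqnorm -[LHS]projection_rip projection_idem. Qed.

Lemma sqnorm_projectionB x : sqnorm (x - P x) = sqnorm x - sqnorm (P x).
Proof.
by rewrite sqnormB ripC -sqnorm_projection; ring.
Qed.

Lemma sqnorm_projection_le x : sqnorm (P x) <= sqnorm x.
Proof. by rewrite -subr_ge0 -sqnorm_projectionB sqnorm_ge0. Qed.

(** By Pythagoras, equality of the norms forces [x - P x = 0]. *)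
Lemma range_projection :
  range P = [set x | sqnorm (P x) = sqnorm x].
Proof.
apply/seteqP; split=> [_ [x _ <-]|x /= Px]; first by rewrite /= projection_idem.
exists x => //; apply/eqP; rewrite eq_sym -subr_eq0; apply/eqP/sqnorm_eq0.
by rewrite sqnorm_projectionB Px subrr.
Qed.

End projection.

Lemma projection_id : is_projection ip id.
Proof. by split => //; exists 1 => x; rewrite mul1r. Qed.

(** * The order of projections, read off their quadratic forms *)

Section projection_order.
Variables P Q : H -> H.
Hypotheses (hP : is_projection ip P) (hQ : is_projection ip Q).
Hypothesis QP : forall x, sqnorm (Q x) <= sqnorm (P x).

(** [P] kills [x - P x], hence so does [Q], whose form is smaller. *)
Lemma projection_le_compr x : Q (P x) = Q x.
Proof.
apply/eqP; rewrite -subr_eq0 -(projectionB hQ); apply/eqP/sqnorm_eq0/eqP.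
rewrite eq_le sqnorm_ge0 andbT (le_trans (QP _))// (projectionB hP).
by rewrite (projection_idem hP) subrr sqnorm0.
Qed.

(** This is the adjoint of [projection_le_compr]. *)
Lemma projection_le_compl x : P (Q x) = Q x.
Proof.
apply: rip_ext => y.
by rewrite (projection_rip hP) !(projection_rip hQ) projection_le_compr.
Qed.

Lemma projection_sub : is_projection ip (fun x => P x - Q x).
Proof.
apply: is_projection_rip => [a x y|x y|x].
- case: hP => linP _ _ _; case: hQ => linQ _ _ _.
  by rewrite linP linQ scalerBr opprD addrACA.
- by rewrite ripBl ripBr (projection_rip hP) (projection_rip hQ).
- rewrite (projectionB hP) (projectionB hQ) !projection_idem //.
  by rewrite projection_le_compr projection_le_compl subrr subr0.
Qed.

(** As [Q (P x) = Q x], this is Pythagoras for [Q] at the vector [P x]. *)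
Lemma sqnorm_projection_sub x :
  sqnorm (P x - Q x) = sqnorm (P x) - sqnorm (Q x).
Proof.
by rewrite -{1}(projection_le_compr x) (sqnorm_projectionB hQ) projection_le_compr.
Qed.

End projection_order.

(** Each projection dominates the other, so [P (Q x)] equals both [P x] and [Q x]. *)
Lemma projection_ext (P Q : H -> H) :
  is_projection ip P -> is_projection ip Q ->
  (forall x, sqnorm (P x) = sqnorm (Q x)) -> P = Q.
Proof.
move=> hP hQ PQ; apply/funext => x.
have PleQ y : sqnorm (P y) <= sqnorm (Q y) by rewrite PQ.
have QleP y : sqnorm (Q y) <= sqnorm (P y) by rewrite PQ.
by rewrite -(projection_le_compr hQ hP PleQ x) (projection_le_compl hP hQ QleP).
Qed.

(** [S - P] is a projection with the form of [Q], hence is [Q]. This converts additivity of forms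
    into additivity of operators. *)
Lemma projection_add (S P Q : H -> H) :
  is_projection ip S -> is_projection ip P -> is_projection ip Q ->
  (forall x, sqnorm (S x) = sqnorm (P x) + sqnorm (Q x)) ->
  forall x, S x = P x + Q x.
Proof.
move=> hS hP hQ SPQ x.
have PS y : sqnorm (P y) <= sqnorm (S y) by rewrite SPQ lerDl sqnorm_ge0.
have <- : (fun x => S x - P x) = Q.
  apply: projection_ext => // [|y]; first exact: projection_sub.
  by rewrite sqnorm_projection_sub // SPQ addrAC subrr add0r.
by rewrite addrC subrK.
Qed.

End hilbert_projections.

(** * Strong limits of downward directed families of projections *)

Section directed_projections.
Variables (R : realType) (H : completeNormedModType R[i]) (ip : H -> H -> R[i]).
Hypothesis hip : is_inner_product ip.

(** Convergence along this filter is convergence of [D] as a decreasing net. A net is used because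
    one limit must serve all vectors at once. *)
Definition projection_tails (D : set (H -> H)) : set_system (H -> H) :=
  filter_from D (fun P => [set Q | D Q /\ forall x, sqnorm (Q x) <= sqnorm (P x)]).

Variable D : set (H -> H).
Hypothesis D0 : D !=set0.
Hypothesis Dproj : forall P, D P -> is_projection ip P.
Hypothesis Ddir : forall P Q, D P -> D Q -> exists2 S, D S &
  forall x, sqnorm (S x) <= sqnorm (P x) /\ sqnorm (S x) <= sqnorm (Q x).

Local Notation F := (projection_tails D).

Instance projection_tails_filter : ProperFilter F.
Proof.
apply: filter_from_proper; last by move=> P DP; exists P.
apply: filter_from_filter => // P Q DP DQ.
have [S DS SPQ] := Ddir DP DQ; exists S => // T [DT TS].
by split; split => // x; rewrite (le_trans (TS x))//; have [] := SPQ x.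
Qed.

Lemma near_projection_tails (P : H -> H) : D P ->
  \forall Q \near F, D Q /\ forall x, sqnorm (Q x) <= sqnorm (P x).
Proof. by move=> DP; exists P. Qed.

(** Below a [P] whose form at [x] is within [e ^+ 2] of the infimum,
    [||P x - Q x||^2 = ||P x||^2 - ||Q x||^2] is less than [e ^+ 2]; so the net is Cauchy, and [H]
    is complete. *)
Lemma directed_projections_cvg x : cvg (Q x @[Q --> F]).
Proof.
apply/cauchy_cvgP/cauchy_exP => _ /gt0_complexP[e e0 ->].
have hinf : has_inf [set sqnorm (P x) | P in D].
  split; last by exists 0 => _ [P _ <-]; exact: sqnorm_ge0.
  by case: D0 => P DP; exists (sqnorm (P x)), P.
have [_ [P DP <-] Plt] := inf_adherent (exprn_gt0 2 e0) hinf.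
exists (P x).
apply: filterS (near_projection_tails DP) => Q [DQ QP].
rewrite /= -ball_normE /= norm_lt_sqnorm // (sqnorm_projection_sub hip) //.
- rewrite ltrBlDl (lt_le_trans Plt)// lerD2r ge_inf//; first by case: hinf.
  by exists Q.
- exact: Dproj.
- exact: Dproj.
Qed.

Lemma directed_projections_inf : exists2 E, is_projection ip E &
  forall x, sqnorm (E x) = inf [set sqnorm (P x) | P in D].
Proof.
pose E x := lim (Q x @[Q --> F]).
have EF x : Q x @[Q --> F] --> E x by exact: directed_projections_cvg.
(* Eventually [Q] lies below [P], so [P] fixes [Q x]; pairing with [y] carries this to the limit. *)
have PE P x : D P -> P (E x) = E x.
  move=> DP; apply: (rip_ext hip) => y; rewrite (projection_rip (Dproj DP)).
  have E1 : rip ip (Q x) (P y) @[Q --> F] --> rip ip (E x) (P y) by exact: cvg_ripl.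
  have E2 : rip ip (Q x) y @[Q --> F] --> rip ip (E x) y by exact: cvg_ripl.
  apply: (cvg_unique (@Rhausdorff R) E1); apply: cvg_trans E2; apply: near_eq_cvg.
  near=> Q; have [DQ QP] : D Q /\ forall x, sqnorm (Q x) <= sqnorm (P x).
    by near: Q; exact: near_projection_tails.
  rewrite -(projection_rip (Dproj DP)).
  by rewrite (projection_le_compl hip (Dproj DP) (Dproj DQ) QP).
have inD : \forall Q \near F, D Q.
  by case: D0 => P /near_projection_tails; apply: filterS => Q [].
(* The limit of the forms is at least their infimum, and at most each form [sqnorm (P x)], since
   eventually [Q] lies below [P]. *)
have ED x : inf [set sqnorm (P x) | P in D] = sqnorm (E x).
  have hinf : has_inf [set sqnorm (P x) | P in D].
    split; last by exists 0 => _ [P _ <-]; exact: sqnorm_ge0.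
    by case: D0 => P DP; exists (sqnorm (P x)), P.
  have Ecv : sqnorm (Q x) @[Q --> F] --> sqnorm (E x) by exact: cvg_sqnorm.
  apply/eqP; rewrite eq_le; apply/andP; split.
    rewrite -(cvg_lim _ Ecv)//; apply: limr_ge.
      by apply/cvg_ex; exists (sqnorm (E x)).
    apply: filterS inD => Q DQ; apply: ge_inf; first by case: hinf.
    by exists Q.
  apply: lb_le_inf; first by case: hinf.
  move=> _ [P DP <-].
  rewrite -(cvg_lim _ Ecv)//; apply: limr_le.
    by apply/cvg_ex; exists (sqnorm (E x)).
  by apply: filterS (near_projection_tails DP) => Q [].
exists E => [|x]; last by rewrite ED.
apply: (is_projection_rip hip) => [a x y|x y|x].
- apply: (cvg_unique (@norm_hausdorff _ H) (EF _)).
  have : a *: Q x + Q y @[Q --> F] --> a *: E x + E y.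
    by apply: cvgD => //; apply: cvgZ => //; exact: cvg_cst.
  apply: cvg_trans; apply: near_eq_cvg.
  by apply: filterS inD => Q /Dproj[+ _ _ _] => ->.
- have E1 : rip ip (Q x) y @[Q --> F] --> rip ip (E x) y by exact: cvg_ripl.
  have E2 : rip ip (Q y) x @[Q --> F] --> rip ip (E y) x by exact: cvg_ripl.
  rewrite [RHS](ripC hip); apply: (cvg_unique (@Rhausdorff R) E1).
  apply: cvg_trans E2; apply: near_eq_cvg.
  by apply: filterS inD => Q /Dproj hQ; rewrite (projection_rip hQ) (ripC hip).
(* Idempotence: by [PE] the net evaluated at [E x] is eventually constant. *)
- apply: (cvg_unique (@norm_hausdorff _ H) (EF _)).
  have : (fun=> E x) @ F --> E x by exact: cvg_cst.
  apply: cvg_trans; apply: near_eq_cvg.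
  by apply: filterS inD => Q DQ; rewrite /= PE.
Unshelve. all: by end_near. Qed.

End directed_projections.

(** * The outer measures attached to a projection valued measure *)

Section pvm_outer_measure.
Variables (R : realType) (H : normedModType R[i]) (ip : H -> H -> R[i]).
Variables (Omega : Type) (Alg : set (set Omega)) (p : set Omega -> H -> H).
Hypothesis hip : is_inner_product ip.
Hypothesis algA : is_algebra_of_sets Alg.
Hypothesis pvmA : is_pvm ip Alg p.

Lemma pvm_projection A : Alg A -> is_projection ip (p A).
Proof. by case: pvmA => + _ _; exact. Qed.

(** The form of a projection at [phi] is its [rip] with [phi], linear and continuous in the
    projected vector, so strong convergence of the sums passes to the forms. *)
Lemma pvm_sqnorm_sigma_additive (F : (set Omega)^nat) phi :
  (forall i, Alg (F i)) -> trivIset setT F -> Alg (\bigcup_i F i) ->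
  (fun n => \sum_(i < n) sqnorm (p (F i) phi)) @ \oo
    --> sqnorm (p (\bigcup_i F i) phi).
Proof.
move=> AF tF AUF; case: pvmA => _ _ /(_ F AF tF AUF phi) cvgF.
rewrite (sqnorm_projection hip (pvm_projection AUF)).
have -> : (fun n => \sum_(i < n) sqnorm (p (F i) phi)) =
    (fun n => rip ip (\sum_(i < n) p (F i) phi) phi).
  apply/funext => n; elim: n => [|n IHn].
    by rewrite !big_ord0 /rip (ip0l hip).
  rewrite !big_ord_recr /= (ripDl hip) IHn.
  by rewrite (sqnorm_projection hip (pvm_projection (AF n))).
exact: cvg_ripl.
Qed.

(** Countable additivity on the constant sequence [set0] makes [v *+ n] converge, so its successive
    differences, all equal to [v], tend to 0. *)
Lemma pvm_set0 phi : p set0 phi = 0.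
Proof.
apply: sqnorm_eq0; set v := sqnorm _.
have A0 := algebra_set0 algA.
have : (fun n => \sum_(i < n) v) @ \oo --> v.
  have := @pvm_sqnorm_sigma_additive (fun=> set0) phi (fun=> A0).
  by rewrite bigcup0 // => /(_ _ A0); apply; apply/trivIsetP => *; exact: set0I.
under eq_fun do rewrite sumr_const card_ord.
move=> cv; have cvS : v *+ n.+1 @[n --> \oo] --> v.
  by move/(cvg_comp _ _ (cvg_addnl 1)) : cv.
have cv0 : v @[_ --> \oo] --> 0.
  rewrite -(subrr v) (_ : (fun=> v) = fun n => v *+ n.+1 - v *+ n).
    exact: cvgB.
  by apply/funext => n; rewrite mulrS addrK.
have cvv : v @[_ --> \oo] --> v by exact: cvg_cst.
by rewrite -[LHS](cvg_lim (@Rhausdorff R) cvv) (cvg_lim (@Rhausdorff R) cv0).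
Qed.

(** Packages the bare function [Mstar] as an outer measure, which opens the Caratheodory theory to
    it. *)
Lemma Mstar_outer_measure phi :
  exists nu : {outer_measure set Omega -> \bar R},
    [/\ nu = Mstar Alg p phi :> (set Omega -> \bar R),
        forall A, Alg A -> nu A = (sqnorm (p A phi))%:E
      & <<s Alg >> `<=` nu.-caratheodory].
Proof.
have [||F AF tF AUF|nu [nuE nuA nuS]] :=
  @premeasure_extension R _ _ (fun A => (sqnorm (p A phi))%:E) algA.
- by rewrite pvm_set0 sqnorm0.
- by move=> A; rewrite lee_fin sqnorm_ge0.
- under eq_fun do rewrite sumEFin big_mkord.
  by apply: cvg_EFin; [exact: nearW|exact: pvm_sqnorm_sigma_additive].
by exists nu; split => //; apply/funext => X; exact: nuE.
Qed.

Lemma Mstar_algebra phi A : Alg A ->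
  Mstar Alg p phi A = (sqnorm (p A phi))%:E.
Proof. by move=> AA; have [nu [<- -> //]] := Mstar_outer_measure phi. Qed.

Lemma Mstar_setT phi : Mstar Alg p phi setT = (sqnorm phi)%:E.
Proof. by case: algA => AT _ _; rewrite Mstar_algebra//; case: pvmA => _ ->. Qed.

Lemma sub_Mcarath : <<s Alg >> `<=` Mcarath Alg p.
Proof.
by move=> A sA phi; have [nu [<- _]] := Mstar_outer_measure phi; exact.
Qed.

Lemma Mstar_ge0 phi X : (0 <= Mstar Alg p phi X)%E.
Proof.
by have [nu [<- _ _]] := Mstar_outer_measure phi; exact: outer_measure_ge0.
Qed.

Lemma le_Mstar phi X Y : X `<=` Y ->
  (Mstar Alg p phi X <= Mstar Alg p phi Y)%E.
Proof.
by have [nu [<- _ _]] := Mstar_outer_measure phi; exact: le_outer_measure.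
Qed.

(** The bound is [||phi||^2]; finiteness allows the comparison with real infima later. *)
Lemma Mstar_fin_num phi X : Mstar Alg p phi X \is a fin_num.
Proof.
rewrite ge0_fin_numE ?Mstar_ge0//; apply: le_lt_trans (ltry (sqnorm phi)).
by rewrite -Mstar_setT; exact: le_Mstar.
Qed.

Lemma Mstar_setC phi A : Mcarath Alg p A ->
  (Mstar Alg p phi A + Mstar Alg p phi (~` A))%E = (sqnorm phi)%:E.
Proof. by move=> MA; rewrite -Mstar_setT (MA phi setT) !setTI. Qed.

Lemma Mstar_bigcup phi (F : (set Omega)^nat) :
  (forall i, Mcarath Alg p (F i)) -> trivIset setT F ->
  Mstar Alg p phi (\bigcup_i F i) = (\sum_(i <oo) Mstar Alg p phi (F i))%E.
Proof.
move=> MF tF; have [nu [nuE _ _]] := Mstar_outer_measure phi.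
rewrite -nuE; apply: caratheodory_sigma_additive => // i.
by rewrite nuE; exact: MF.
Qed.

Lemma Mstar_bigsetU phi (F : (set Omega)^nat) n :
  (forall i, Mcarath Alg p (F i)) -> trivIset setT F ->
  Mstar Alg p phi (\big[setU/set0]_(i < n) F i) =
  (\sum_(i < n) Mstar Alg p phi (F i))%E.
Proof.
move=> MF tF; have [nu [nuE _ _]] := Mstar_outer_measure phi.
rewrite -nuE; apply: caratheodory_finitely_additive => // i.
by rewrite nuE; exact: MF.
Qed.

Lemma Mstar_bigsetU_cvg phi (F : (set Omega)^nat) :
  (forall i, Mcarath Alg p (F i)) -> trivIset setT F ->
  Mstar Alg p phi (\big[setU/set0]_(i < n) F i) @[n --> \oo] -->
  Mstar Alg p phi (\bigcup_i F i).
Proof.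
move=> MF tF; rewrite Mstar_bigcup//.
under eq_fun do rewrite Mstar_bigsetU//
  -(big_mkord xpredT (fun i => Mstar Alg p phi (F i))).
by apply: is_cvg_nneseries => i _ _; exact: Mstar_ge0.
Qed.

End pvm_outer_measure.

(** The partial unions increase, so intersecting them index by index exhausts the intersection. This
    makes the sets of [Asigma] above a given set directed. *)
Lemma Asigma_setI (Omega : Type) (Alg : set (set Omega)) B C :
  is_algebra_of_sets Alg -> Asigma Alg B -> Asigma Alg C -> Asigma Alg (B `&` C).
Proof.
move=> algA [F [AF ->]] [G [AG ->]].
exists (fun n => (\big[setU/set0]_(i < n) F i) `&` \big[setU/set0]_(i < n) G i).
split=> [n|].
  have AFn := algebra_bigsetU n algA AF; have AGn := algebra_bigsetU n algA AG.
  by rewrite -setDD; do 2?apply: (algebra_setD algA).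
apply/seteqP; split=> [x [[i _ Fx] [j _ Gx]]|x [n _ [Fx Gx]]]; last first.
  by split; apply: bigsetU_bigcup; eassumption.
(* The successor is due to partial unions running over indices strictly below [n]. *)
exists (maxn i j).+1 => //; rewrite -!bigcup_mkord; split.
  by exists i => //=; rewrite ltnS leq_maxl.
by exists j => //=; rewrite ltnS leq_maxr.
Qed.

(** * Projections whose forms are the outer measures *)

Section pvm_extension.
Variables (R : realType) (H : completeNormedModType R[i]) (ip : H -> H -> R[i]).
Variables (Omega : Type) (Alg : set (set Omega)) (p : set Omega -> H -> H).
Hypothesis hip : is_inner_product ip.
Hypothesis algA : is_algebra_of_sets Alg.
Hypothesis pvmA : is_pvm ip Alg p.

Local Notation M := (Mstar Alg p).

(** The projections [p (G n)] increase, so the downward limit is taken on the complements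
    [1 - p (G n)], and the complement of that limit is the witness. *)
Lemma Asigma_projection B : Asigma Alg B -> exists2 E, is_projection ip E &
  forall phi, (sqnorm (E phi))%:E = M phi B.
Proof.
move=> [F [AF BF]]; pose G n := \big[setU/set0]_(k < n) F k.
have AG n : Alg (G n) by exact: (algebra_bigsetU n algA AF).
have pG n := pvm_projection pvmA (AG n).
pose D := [set (fun x => x - p (G n) x) | n in [set: nat]].
have GB n : G n `<=` B by rewrite BF; exact: bigsetU_bigcup.
have normG n x : sqnorm (x - p (G n) x) = sqnorm x - sqnorm (p (G n) x).
  exact: (sqnorm_projectionB hip).
have leG m n x : (m <= n)%N -> sqnorm (x - p (G n) x) <= sqnorm (x - p (G m) x).
  move=> mn; rewrite !normG lerD2l lerN2 -lee_fin.
  rewrite -!(Mstar_algebra hip algA pvmA)//; apply: (le_Mstar hip algA pvmA).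
  exact: subset_bigsetU.
have [||P Q [m _ <-] [n _ <-]|E projE normE] := @directed_projections_inf _ _ _ hip D.
- by exists (fun x => x - p (G 0) x), 0%N.
- move=> _ [n _ <-]; apply: (projection_sub hip (projection_id ip) (pG n)).
  by move=> x; exact: (sqnorm_projection_le hip).
- exists (fun x => x - p (G (maxn m n)) x); first by exists (maxn m n).
  by move=> x; split; apply: leG; rewrite ?leq_maxl ?leq_maxr.
have leE x : sqnorm (E x) <= sqnorm x by exact: (sqnorm_projection_le hip).
exists (fun x => x - E x); first exact: (projection_sub hip (projection_id ip)).
move=> x; rewrite (sqnorm_projectionB hip projE) normE.
have := Mstar_fin_num hip algA pvmA x B.
move MB : (M x B) => b; case: b MB => // b MB _.
have hinf : has_inf [set sqnorm (P x) | P in D].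
  split.
    exists (sqnorm (x - p (G 0) x)), (fun x => x - p (G 0) x) => //.
    by exists 0%N.
  by exists 0 => _ [P _ <-]; exact: sqnorm_ge0.
apply/eqP; rewrite eq_le; apply/andP; split.
  rewrite lee_fin lerBlDl -lerBlDr; apply: lb_le_inf; first by case: hinf.
  move=> _ [_ [n _ <-] <-]; rewrite normG lerD2l lerN2 -lee_fin -MB.
  by rewrite -(Mstar_algebra hip algA pvmA)//; exact: (le_Mstar hip algA pvmA).
(* Making [F] disjoint leaves the partial unions [G n] unchanged and shows that [M x (G n)] tends to
   [M x B]. *)
have sG : \bigcup_n seqDU F n = B by rewrite -seqDU_bigcup_eq BF.
have MG n : Mcarath Alg p (seqDU F n).
  apply: (sub_Mcarath hip algA pvmA); apply: sub_sigma_algebra.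
  by apply: (algebra_setD algA) => //; exact: (algebra_bigsetU n algA AF).
have cvG := Mstar_bigsetU_cvg hip algA pvmA (phi := x) MG (@trivIset_seqDU _ F).
rewrite -MB -[in leLHS]sG -(cvg_lim (@ereal_hausdorff R) cvG); apply: lime_le.
  by apply/cvg_ex; eexists; exact: cvG.
apply: nearW => n; rewrite -bigsetU_seqDU (Mstar_algebra hip algA pvmA _ (AG n)).
rewrite lee_fin lerBrDr -lerBrDl -normG; apply: ge_inf; first by case: hinf.
by exists (fun x => x - p (G n) x) => //; exists n.
Qed.

(** The infimum runs over the sets of [Asigma] above [X], directed by intersection. *)
Lemma Mstar_projection X : exists E, is_projection ip E /\
  forall phi, (sqnorm (E phi))%:E = M phi X.
Proof.
pose D := [set E | is_projection ip E /\ exists2 B, Asigma Alg B /\ X `<=` B &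
  forall phi, (sqnorm (E phi))%:E = M phi B].
have AsT : Asigma Alg setT.
  by exists (fun=> setT); split; [case: algA|rewrite bigcup_const//; exists 0%N].
have [||P Q|E projE normE] := @directed_projections_inf _ _ _ hip D.
- by have [E pE nE] := Asigma_projection AsT; exists E; split => //; exists setT.
- by move=> P [].
- move=> [pP [B [AB XB] PB]] [pQ [C [AC XC] QC]].
  have ABC := Asigma_setI algA AB AC.
  have [S pS SBC] := Asigma_projection ABC.
  exists S; first split => //.
    exists (B `&` C) => //; split => // x Xx.
    by split; [exact: XB|exact: XC].
  move=> x; rewrite -!lee_fin SBC PB QC.
  by split; apply: (le_Mstar hip algA pvmA) => ? [].
exists E; split=> // x; rewrite normE.
have hinf : has_inf [set sqnorm (P x) | P in D].
  split; last by exists 0 => _ [P _ <-]; exact: sqnorm_ge0.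
  have [T pT nT] := Asigma_projection AsT.
  by exists (sqnorm (T x)), T => //; split => //; exists setT.
apply/eqP; rewrite eq_le; apply/andP; split.
  (* The union of a cover of [X] is one of these sets, and its outer measure is at most the sum over
     the cover. *)
  apply: le_ereal_inf_tmp => _ [F [AF XF] <-].
  have AB : Asigma Alg (\bigcup_i F i) by exists F.
  have [T pT nT] := Asigma_projection AB.
  apply: (@le_trans _ _ (M x (\bigcup_i F i))); last first.
    by apply: ereal_inf_lbound; exists F => //; split.
  rewrite -nT lee_fin; apply: ge_inf; first by case: hinf.
  by exists T => //; split => //; exists (\bigcup_i F i).
have := Mstar_fin_num hip algA pvmA x X.
move MX : (M x X) => b; case: b MX => // b MX _; rewrite lee_fin.
apply: lb_le_inf; first by case: hinf.
move=> _ [P [_ [B [_ XB] PB]] <-]; rewrite -lee_fin -MX PB.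
exact: (le_Mstar hip algA pvmA).
Qed.

(** * The extension: agreement, ranges, countable additivity, uniqueness *)

Variable q : set Omega -> H -> H.
Hypothesis qproj : forall A, is_projection ip (q A).
Hypothesis qM : forall A phi, (sqnorm (q A phi))%:E = M phi A.

Lemma Mstar_pvm_algebra A : Alg A -> q A = p A.
Proof.
move=> AA; apply: (projection_ext hip (qproj A) (pvm_projection pvmA AA)) => x.
by apply: EFin_inj; rewrite qM (Mstar_algebra hip algA pvmA).
Qed.

Lemma Mstar_pvm_range A : range (q A) = [set phi | M phi A = (sqnorm phi)%:E].
Proof.
rewrite (range_projection hip (qproj A)); apply/seteqP; split=> x /=.
  by rewrite -qM => ->.
by rewrite -qM => -[].
Qed.

(** For [x] in the intersection, any cover of [A] has mass at least [M x B = ||x||^2], with [B] its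
    union, so [M x A] attains its upper bound. The converse is monotonicity of [M x]. *)
Lemma Mstar_pvm_bigcap A : range (q A) =
  \bigcap_(B in [set B | Asigma Alg B /\ A `<=` B]) range (q B).
Proof.
have le_norm x B : (M x B <= (sqnorm x)%:E)%E.
  by rewrite -(Mstar_setT hip algA pvmA); exact: (le_Mstar hip algA pvmA).
apply/seteqP; split=> x.
  rewrite Mstar_pvm_range /= => MA B [_ AB]; rewrite Mstar_pvm_range /=.
  apply/eqP; rewrite eq_le le_norm /= -MA; exact: (le_Mstar hip algA pvmA).
move=> xB; rewrite Mstar_pvm_range /=; apply/eqP; rewrite eq_le le_norm /=.
apply: le_ereal_inf_tmp => _ [F [AF AUF] <-].
have /xB : [set B | Asigma Alg B /\ A `<=` B] (\bigcup_i F i).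
  by split => //; exists F.
by rewrite Mstar_pvm_range /= => <-; apply: ereal_inf_lbound; exists F => //; split.
Qed.

Lemma Mstar_pvm : is_pvm ip (Mcarath Alg p) q.
Proof.
split=> // [phi|F MF tF _ phi].
  by rewrite Mstar_pvm_algebra; [case: pvmA => _ ->|case: algA].
(* Finite additivity of [M] is additivity of the forms, which [projection_add] lifts to the
   operators. *)
have sumq n x : \sum_(i < n) q (F i) x = q (\big[setU/set0]_(i < n) F i) x.
  elim: n => [|n IHn].
    rewrite !big_ord0 Mstar_pvm_algebra; last exact: algebra_set0.
    by rewrite (pvm_set0 hip algA pvmA).
  rewrite big_ord_recr /= IHn; apply/esym.
  apply: (projection_add hip (qproj _) (qproj _) (qproj _)) => y.
  apply: EFin_inj; rewrite EFinD !qM !(Mstar_bigsetU hip algA pvmA)//.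
  by rewrite big_ord_recr.
apply/cvg_sqnormP => e e0.
have cvF := Mstar_bigsetU_cvg hip algA pvmA (phi := phi) MF tF.
have : sqnorm (q (\big[setU/set0]_(i < n) F i) phi) @[n --> \oo] -->
    sqnorm (q (\bigcup_i F i) phi).
  move: cvF; rewrite -qM; under eq_fun do rewrite -qM.
  by move=> /fine_cvgP[].
move=> /cvgrPdist_lt/(_ _ e0); apply: filterS => n.
(* The squared distance to the limit is a difference of forms, so convergence of the forms already
   gives strong convergence. *)
rewrite sumq (sqnorm_projection_sub hip (qproj _) (qproj _)); last first.
  move=> x; rewrite -lee_fin !qM; apply: (le_Mstar hip algA pvmA).
  exact: bigsetU_bigcup.
by apply: le_lt_trans; exact: ler_norm.
Qed.

Lemma Mstar_pvm_unique (r : set Omega -> H -> H) :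
  is_pvm ip <<s Alg >> r -> (forall A, Alg A -> r A = p A) ->
  forall A, <<s Alg >> A -> r A = q A.
Proof.
move=> pvmr rA A sA.
have sC B : <<s Alg >> B -> <<s Alg >> (~` B).
  by move=> sB; rewrite -setTD; exact: (sigma_algebraCD sB).
(* With [<<s Alg >>] seen as an algebra, the results on outer measures apply to [r] as well. *)
have algS : is_algebra_of_sets <<s Alg >>.
  split=> // [|B C sB sC'].
    by have := sC _ (@sigma_algebra0 _ setT Alg); rewrite setC0.
  rewrite -bigcup2E; apply: sigma_algebra_bigcup => -[|[|i]] //=.
  exact: (@sigma_algebra0 _ setT Alg).
(* The form of [r] is its own outer measure, an infimum over more covers than [M], with equal sums
   on those from [Alg]. *)
have le_r x B : <<s Alg >> B -> ((sqnorm (r B x))%:E <= M x B)%E.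
  move=> sB; rewrite -(Mstar_algebra hip algS pvmr)//.
  apply: ereal_inf_le_tmp => _ [F [AF BF] <-]; exists F.
    by split => // i; exact: sub_sigma_algebra.
  by apply: eq_eseriesr => i _; rewrite rA.
have pr := pvm_projection pvmr sA.
apply: (projection_ext hip pr (qproj A)) => x; apply: EFin_inj; rewrite qM.
apply/eqP; rewrite eq_le le_r//=.
have MA := sub_Mcarath hip algA pvmA sA.
have MAr : Mcarath <<s Alg >> r A.
  by apply: (sub_Mcarath hip algS pvmr); exact: sub_sigma_algebra.
(* The values at [A] and its complement add up to [||x||^2] both for [r] and for [M], so [le_r] at
   the complement reverses the inequality at [A]. *)
have := Mstar_setC hip algS pvmr x MAr.
rewrite (Mstar_algebra hip algS pvmr x sA).
rewrite (Mstar_algebra hip algS pvmr x (sC _ sA)) -(Mstar_setC hip algA pvmA x MA).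
have := le_r x (~` A) (sC _ sA); rewrite -!qM -!EFinD !lee_fin.
by move=> leC [eqA]; lra.
Qed.

End pvm_extension.

Theorem theorem5 (R : realType) (H : completeNormedModType R[i])
    (ip : H -> H -> R[i]) (Omega : Type) (Alg : set (set Omega))
    (p : set Omega -> H -> H) :
  is_inner_product ip -> is_algebra_of_sets Alg -> is_pvm ip Alg p ->
  exists q : set Omega -> H -> H,
    [/\ is_pvm ip (Mcarath Alg p) q,
        (forall A, Alg A -> q A = p A),
        (forall phi A, Mcarath Alg p A ->
           ((sqnorm (q A phi))%:E = Mstar Alg p phi A)%E),
        (forall A, Mcarath Alg p A ->
           range (q A) = [set phi | Mstar Alg p phi A = (sqnorm phi)%:E])
      & [/\ (forall A, Mcarath Alg p A ->
           range (q A) =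
             \bigcap_(B in [set B | Asigma Alg B /\ A `<=` B]) range (q B)),
        is_pvm ip (<<s Alg >>) q
      & forall r : set Omega -> H -> H,
          is_pvm ip (<<s Alg >>) r -> (forall A, Alg A -> r A = p A) ->
          forall A, <<s Alg >> A -> r A = q A]].
Proof.
move=> hip algA pvmA.
(* By [projection_ext] the form determines each [q A], so nothing depends on the choice. *)
have [q hq] := choice (Mstar_projection hip algA pvmA).
have qproj A : is_projection ip (q A) by have [] := hq A.
have qM A phi : (sqnorm (q A phi))%:E = Mstar Alg p phi A by have [_ ->] := hq A.
have pvmM := Mstar_pvm hip algA pvmA qproj qM.
exists q; split=> //.
- exact: (Mstar_pvm_algebra hip algA pvmA qproj qM).
- by move=> A _; exact: (Mstar_pvm_range hip qproj qM).
split.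
- by move=> A _; exact: (Mstar_pvm_bigcap hip algA pvmA qproj qM).
- have sM := sub_Mcarath hip algA pvmA.
  case: pvmM => projM idM addM; split=> // F sF tF sUF.
  by apply: addM => // [i|]; exact: sM.
- exact: (Mstar_pvm_unique hip algA pvmA qproj qM).
Qed.
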